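(* Let $G$ be a finite group and $\Gamma\subset G$ a union of conjugacy classes. Suppose $v,w$ are Hurwitz vectors generating $G$ with entries in $\Gamma$, and $\nu(v)\ge\nu(u_\Gamma^m)$, where $m$ is a $\Gamma$-stability bound. Then $$v\approx w\quad\iff\quad [v/1]=[w/1]\in\mathcal H_{G,\Gamma}\,\mathcal S_\Gamma^{-1}.$$
   Context: A Hurwitz vector (of genus $0$) for $G$ is an element $v=(v_1,\dots,v_d)$ of $\coprod_{d\ge0}G^d$. The braid group $\mathrm{Br}_d$ acts on $G^d$ by the Hurwitz action, in which the standard generators act by $(\dots,v_i,v_{i+1},\dots)\mapsto(\dots,v_{i+1},v_{i+1}^{-1}v_iv_{i+1},\dots)$. Two Hurwitz vectors are braid equivalent, $v\approx w$, if they lie in the same braid group orbit; $[v]_\approx$ is the class of $v$. Juxtaposition of tuples is written as a product; $\langle v\rangle=\langle v_1,\dots,v_d\rangle$, and $v$ generates $H$ if $\langle v\rangle=H$. The Nielsen map $\nu:\coprod_d G^d\to\bigoplus_i\mathbb Z\,\mathcal C_i$ (sum over the conjugacy classes of $G$) is $\nu(v)=\sum_i\nu_i\mathcal C_i$ with $\nu_i=\#\{j\mid v_j\in\mathcal C_i\}$; the target is partially ordered coefficientwise. With $g_1,\dots,g_r$ an enumeration of the elements of $\Gamma$, $u_\Gamma=(g_1,\dots,g_1,\dots,g_r,\dots,g_r)$, each $g_i$ repeated $\mathrm{ord}(g_i)$ times. $\Gamma$-stability bound: for $\Gamma$ generating $G$, an integer $m$ is a $\Gamma$-stability bound if (i)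 for all $\nu_1\ge\nu_0\ge m\,\nu(u_\Gamma)$ with $\nu_0,\nu_1\in\nu(\coprod_d\Gamma^d)$, all subgroups $H\subset G$ and all $u\in\coprod_d H^d$ with $\nu(u)+\nu_0=\nu_1$, the map $[x]_\approx\mapsto[xu]_\approx$ from $\{[x]_\approx\mid\nu(x)=\nu_0,\langle x\rangle=H\}$ to $\{[x]_\approx\mid\nu(x)=\nu_1,\langle x\rangle=H\}$ is bijective; and (ii) for all $\nu_0,\nu_1\ge m\,\nu(u_\Gamma)$ in $\nu(\coprod_d\Gamma^d)$, $\#\{[x]_\approx\mid\nu(x)=\nu_0\}=\#\{[x]_\approx\mid\nu(x)=\nu_1\}$. $\mathcal H_{G,\Gamma}=\coprod_{d\ge0}\Gamma^d/\mathrm{Br}_d$ is the monoid with product induced by juxtaposition (unit the empty tuple). $\mathcal S_\Gamma$ is its submonoid generated by the class of $u_\Gamma$; it is central. $\mathcal H_{G,\Gamma}\mathcal S_\Gamma^{-1}$ is the monoid of fractions $[x/s]$, $x\in\mathcal H_{G,\Gamma}$, $s\in\mathcal S_\Gamma$, where $[x/s]=[x'/s']$ iff there are $\tilde r\in\mathcal H_{G,\Gamma}$, $\tilde s\in\mathcal S_\Gamma$ with $x\tilde r=x'\tilde s$ and $s\tilde r=s'\tilde s$. *)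

(* Defs.v *)
From HB Require Import structures.
From mathcomp Require Import all_boot all_order all_algebra all_fingroup.
From mathcomp Require Import boolp classical_sets functions cardinality.

Set Implicit Arguments.
Unset Strict Implicit.
Unset Printing Implicit Defensive.

Import Order.TTheory GRing.Theory Num.Theory.

Local Notation repr := generic_quotient.repr.

Local Open Scope group_scope.
Local Open Scope quotient_scope.

(* A finite group is the whole carrier of a [finGroupType], so a Hurwitz      *)
(* vector (an element of the disjoint union of the [G ^ d], d >= 0) is a      *)
(* [seq G], and juxtaposition is [++].                                        *)

Section BraidAction.
Variable G : finGroupType.
Implicit Types (v w : seq G) (i : nat).

(* The standard generator number [i], counted from 0; with MathComp's         *)
(* convention [x ^ y = y^-1 * (x * y)]. Off range, it is the identity.        *)
Fixpoint sigma i v : seq G :=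
  match i, v with
  | 0, [:: x, y & s] => [:: y, x ^ y & s]
  | j.+1, x :: s => x :: sigma j s
  | _, _ => v
  end.

Fixpoint sigmaV i v : seq G :=
  match i, v with
  | 0, [:: x, y & s] => [:: y ^ x^-1, x & s]
  | j.+1, x :: s => x :: sigmaV j s
  | _, _ => v
  end.

Definition letter_act (l : nat * bool) v :=
  if l.2 then sigmaV l.1 v else sigma l.1 v.

(* Elements of Br_d are represented by words in the [d.-1] standard           *)
(* generators and their inverses ([true] marks an inverse); [sigmaK],         *)
(* [sigmaVK], [sigma_comm] and [sigma_braid] below say that the action of     *)
(* words factors through Br_d.                                                *)
Definition braid_word (d : nat) := seq ('I_d.-1 * bool).

Definition braid_act d (b : braid_word d) v : seq G :=
  foldl (fun s l => letter_act (val l.1, l.2) s) v b.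

Definition braid_equiv v w : Prop :=
  exists b : braid_word (size v), braid_act b v = w.

Lemma sigmaK i : cancel (sigma i) (sigmaV i).
Proof.
elim: i => [|i IH] [|x [|y s]] //=; last 2 first.
- by rewrite IH.
- by rewrite IH.
by rewrite -conjgM mulgV conjg1.
Qed.

Lemma sigmaVK i : cancel (sigmaV i) (sigma i).
Proof.
elim: i => [|i IH] [|x [|y s]] //=; last 2 first.
- by rewrite IH.
- by rewrite IH.
by rewrite -conjgM mulVg conjg1.
Qed.

Lemma size_sigma i v : size (sigma i v) = size v.
Proof. by elim: i v => [|i IH] [|x [|y s]] //=; rewrite IH. Qed.

Lemma size_sigmaV i v : size (sigmaV i v) = size v.
Proof. by rewrite -{2}(sigmaVK i v) size_sigma. Qed.

Lemma sigma_comm i j v :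
  i.+1 < j -> sigma i (sigma j v) = sigma j (sigma i v).
Proof.
elim: i j v => [|i IH] [|j] //; last first.
  by case=> //= x s ij; rewrite IH.
by case: j => [|j] // [|x [|y s]].
Qed.

Lemma sigma_braid i v : i.+2 < size v ->
  sigma i (sigma i.+1 (sigma i v)) = sigma i.+1 (sigma i (sigma i.+1 v)).
Proof.
elim: i v => [|i IH] [|x s] //=; last by move=> /IH ->.
by case: s => [|y [|z s]] //= _; rewrite conjJg.
Qed.

Definition word_act (b : seq (nat * bool)) v := foldl (fun s l => letter_act l s) v b.

Lemma size_letter l v : size (letter_act l v) = size v.
Proof. by case: l => i [] /=; rewrite (size_sigma, size_sigmaV). Qed.

Lemma size_word b v : size (word_act b v) = size v.
Proof. by elim: b v => //= l b IH v; rewrite IH size_letter. Qed.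

Lemma letter_oor l v : size v <= l.1.+1 -> letter_act l v = v.
Proof.
case: l => i e /= iv; rewrite /letter_act /=.
suff [-> ->] : sigma i v = v /\ sigmaV i v = v by case: e.
elim: i v iv => [|i IH] [|x s] //=; first by case: s.
by move=> /IH[-> ->].
Qed.

Lemma braid_equivE v w :
  braid_equiv v w <-> exists b : seq (nat * bool), word_act b v = w.
Proof.
split=> [[b <-]|[b <-]].
  move: (size v) b => d b; exists [seq (nat_of_ord l.1, l.2) | l <- b].
  by elim: b v => //= l b IH v; rewrite -IH.
suff [b' E] : exists b' : braid_word (size v), braid_act b' v = word_act b v.
  by exists b'.
move: {-2}(size v) (erefl (size v)) => d.
elim: b v => [|[i e] b IH] v vd; first by exists [::].
have [b' E] := IH (letter_act (i, e) v) (etrans vd (esym (size_letter _ _))).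
have [id|id] := ltnP i d.-1; first by exists ((Ordinal id, e) :: b').
exists b'; rewrite -[in LHS](@letter_oor (i, e) v) //= -vd.
by move: id; clear; case: d.
Qed.

Lemma braid_equiv_refl v : braid_equiv v v.
Proof. by exists [::]. Qed.

Lemma braid_equiv_trans v w x :
  braid_equiv v w -> braid_equiv w x -> braid_equiv v x.
Proof.
move=> /braid_equivE[b <-] /braid_equivE[c <-]; apply/braid_equivE.
by exists (b ++ c); rewrite /word_act foldl_cat.
Qed.

Lemma braid_equiv_sym v w : braid_equiv v w -> braid_equiv w v.
Proof.
move=> /braid_equivE[b <-]; elim: b v => [|[i e] b IH] v.
  exact: braid_equiv_refl.
apply: braid_equiv_trans (IH _) _; apply/braid_equivE.
exists [:: (i, ~~ e)]; rewrite /word_act /letter_act.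
by case: e => /=; rewrite (sigmaK, sigmaVK).
Qed.

Lemma braid_equiv_size v w : braid_equiv v w -> size v = size w.
Proof. by move=> /braid_equivE[b <-]; rewrite size_word. Qed.

Lemma braid_equiv_cons x v w :
  braid_equiv v w -> braid_equiv (x :: v) (x :: w).
Proof.
move=> /braid_equivE[b <-]; apply/braid_equivE.
exists [seq (l.1.+1, l.2) | l <- b].
by elim: b v => //= -[i e] b IH v; rewrite -IH; case: e.
Qed.

Lemma braid_equiv_cat v v' w w' :
  braid_equiv v v' -> braid_equiv w w' -> braid_equiv (v ++ w) (v' ++ w').
Proof.
move=> vv' ww'; apply: (@braid_equiv_trans _ (v ++ w')).
  by elim: v {vv'} => //= x v; apply: braid_equiv_cons.
move/braid_equivE: vv' => [b <-] {v' w ww'}.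
elim: b v => [|[i e] b IH] v; first exact: braid_equiv_refl.
apply: braid_equiv_trans (IH _); apply/braid_equivE.
have [iv|iv] := leqP (size v) i.+1.
  by exists [::]; rewrite /= letter_oor.
exists [:: (i, e)]; rewrite /word_act /letter_act /=.
have [E1 E2] : sigma i (v ++ w') = sigma i v ++ w' /\
               sigmaV i (v ++ w') = sigmaV i v ++ w'.
  elim: i v iv {IH} => [|i IH] [|x s] //=; first by case: s.
  by move=> /IH[-> ->].
by case: e.
Qed.

Lemma braid_equiv_swap x v :
  braid_equiv (x :: v) (v ++ [:: x ^ (\prod_(g <- v) g)]).
Proof.
elim: v x => [|y v IH] x; first by rewrite big_nil conjg1; exact: braid_equiv_refl.
rewrite big_cons conjgM.
apply: (@braid_equiv_trans _ [:: y, x ^ y & v]).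
  by apply/braid_equivE; exists [:: (0, false)].
by rewrite cat_cons; exact: braid_equiv_cons.
Qed.

Definition braid_equivb : rel (seq G) := fun v w => `[< braid_equiv v w >].

Lemma braid_equivb_refl : reflexive braid_equivb.
Proof. by move=> v; apply/asboolP; exact: braid_equiv_refl. Qed.

Lemma braid_equivb_sym : symmetric braid_equivb.
Proof. by move=> v w; apply/asboolP/asboolP; exact: braid_equiv_sym. Qed.

Lemma braid_equivb_trans : transitive braid_equivb.
Proof.
move=> v u w /asboolP uv /asboolP vw; apply/asboolP.
exact: braid_equiv_trans uv vw.
Qed.

Canonical braid_equiv_rel :=
  EquivRel braid_equivb braid_equivb_refl braid_equivb_sym braid_equivb_trans.

Definition hclass := {eq_quot braid_equiv_rel}.
HB.instance Definition _ := Choice.on hclass.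
HB.instance Definition _ := EqQuotient.on hclass.

Definition hcl (v : seq G) : hclass := \pi_hclass v.

Lemma hclP v w : hcl v = hcl w <-> braid_equiv v w.
Proof.
split; first by move=> /eqmodP /asboolP.
by move=> vw; apply/eqmodP/asboolP.
Qed.

Definition hmul (c c' : hclass) : hclass := hcl (repr c ++ repr c').

Lemma hmulE v w : hmul (hcl v) (hcl w) = hcl (v ++ w).
Proof. by apply/hclP; apply: braid_equiv_cat; apply/hclP; rewrite /hcl reprK. Qed.

Lemma hcl_repr (c : hclass) : hcl (repr c) = c.
Proof. by rewrite /hcl reprK. Qed.

Lemma hmulA : associative hmul.
Proof.
move=> a b c; rewrite -(hcl_repr a) -(hcl_repr b) -(hcl_repr c).
by rewrite !hmulE catA.
Qed.

Lemma hmul1 : left_id (hcl [::]) hmul.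
Proof. by move=> a; rewrite -(hcl_repr a) hmulE. Qed.

Lemma hmulr1 : right_id (hcl [::]) hmul.
Proof. by move=> a; rewrite -(hcl_repr a) hmulE cats0. Qed.

HB.instance Definition _ := isMonoid.Build hclass hmulA hmul1 hmulr1.

Lemma hcl_cat v w : hcl (v ++ w) = hcl v * hcl w.
Proof. by rewrite -hmulE. Qed.

Lemma hcl_nil : hcl [::] = 1.
Proof. by []. Qed.

Lemma hclass_ind (P : hclass -> Prop) : (forall v, P (hcl v)) -> forall c, P c.
Proof. by move=> Pv c; rewrite -(hcl_repr c). Qed.

End BraidAction.

Section Hurwitz.
Variable G : finGroupType.
Implicit Types (v w : seq G) (Gamma : {set G}) (H : {group G}).

Definition union_of_classes Gamma : Prop :=
  exists2 P : {set {set G}}, P \subset classes [set: G]%SET & finset.cover P = Gamma.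

Definition generated_by v : {set G} := <<[set g in v]%SET>>.

Definition vectors (A : {set G}) : set (seq G) := [set v | all [in A] v]%classic.

Definition conj_class := {C : {set G} | C \in classes [set: G]%SET}.

Definition nielsen v : {ffun conj_class -> int} :=
  [ffun C : conj_class => Posz (count [in val C] v)].

Definition nielsen_le (nu nu' : {ffun conj_class -> int}) : Prop :=
  forall C, (nu C <= nu' C)%R.

Definition nielsen_image Gamma : set {ffun conj_class -> int} :=
  [set nielsen v | v in vectors Gamma]%classic.

Definition uvec_of (e : seq G) : seq G := flatten [seq nseq #[g] g | g <- e].

(* The enumeration chosen by the library; any other one gives the same class, *)
(* by [hcl_uvec] below.                                                       *)
Definition uvec Gamma : seq G := uvec_of (enum Gamma).

Lemma nielsen_cat v w : nielsen (v ++ w) = (nielsen v + nielsen w)%R.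
Proof. by apply/ffunP=> C; rewrite !ffunE count_cat PoszD. Qed.

(* [flatten (nseq m v)] is the m-th power of [v] for juxtaposition, so that   *)
(* for m >= 0 [nielsen v *~ m] is the Nielsen type of that power.             *)
Lemma nielsen_pow v (m : nat) :
  nielsen (flatten (nseq m v)) = (nielsen v *+ m)%R.
Proof.
elim: m => [|m IH]; first by apply/ffunP=> C; rewrite !ffunE.
by rewrite /= nielsen_cat IH GRing.mulrS.
Qed.

Lemma hcl_comm v w : \prod_(g <- v) g = 1 -> hcl v * hcl w = hcl w * hcl v.
Proof.
move=> v1; elim: w => [|x w IH]; first by rewrite hcl_nil mulg1 mul1g.
rewrite -cat1s !hcl_cat -[RHS]mulgA -IH !mulgA; congr (_ * _).
rewrite -!hcl_cat; apply/esym/hclP.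
by have := braid_equiv_swap x v; rewrite v1 conjg1.
Qed.

Lemma prod_nseq_order (g : G) : \prod_(h <- nseq #[g] g) h = 1.
Proof. by rewrite big_nseq iter_mulg_1 expg_order. Qed.

Lemma prod_uvec_of e : \prod_(g <- uvec_of e) g = 1.
Proof.
by elim: e => [|g e IH]; rewrite /uvec_of /= ?big_nil // big_cat /=
  prod_nseq_order mul1g.
Qed.

Lemma uvec_of_cat e e' : uvec_of (e ++ e') = uvec_of e ++ uvec_of e'.
Proof. by rewrite /uvec_of map_cat flatten_cat. Qed.

Lemma hcl_uvec Gamma e : uniq e -> e =i Gamma -> hcl (uvec_of e) = hcl (uvec Gamma).
Proof.
move=> ue eG; have : perm_eq e (enum Gamma).
  by apply: uniq_perm; rewrite ?enum_uniq // => g; rewrite eG mem_enum.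
apply: (@catCA_perm_subst _ _ (fun e => hcl (uvec_of e))) => s1 s2 s3.
rewrite !uvec_of_cat !hcl_cat !mulgA; congr (_ * _).
by apply: hcl_comm; exact: prod_uvec_of.
Qed.

Definition classes_gen (nu : {ffun conj_class -> int}) H : set (hclass G) :=
  [set hcl x | x in [set x | nielsen x = nu /\ generated_by x = H]]%classic.

Definition classes_type (nu : {ffun conj_class -> int}) : set (hclass G) :=
  [set hcl x | x in [set x | nielsen x = nu]]%classic.

(* Meant for [Gamma] generating [G], which is not repeated as a clause. A      *)
(* tuple whose Nielsen type is in [nielsen_image Gamma] has its entries in    *)
(* [Gamma] as soon as [Gamma] is a union of classes.                          *)
Definition stability_bound Gamma (m : int) : Prop :=
  (forall nu0 nu1, nielsen_image Gamma nu0 -> nielsen_image Gamma nu1 ->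
     nielsen_le (nielsen (uvec Gamma) *~ m)%R nu0 -> nielsen_le nu0 nu1 ->
     forall (H : {group G}) (u : seq G),
       vectors H u -> (nielsen u + nu0)%R = nu1 ->
       set_bij (classes_gen nu0 H) (classes_gen nu1 H) (fun c => c * hcl u))
  /\
  (forall nu0 nu1, nielsen_image Gamma nu0 -> nielsen_image Gamma nu1 ->
     nielsen_le (nielsen (uvec Gamma) *~ m)%R nu0 ->
     nielsen_le (nielsen (uvec Gamma) *~ m)%R nu1 ->
     (classes_type nu0 #= classes_type nu1)%card).

(* The monoid H_(G,Gamma) as a submonoid of the monoid of all classes; the    *)
(* braid action preserves [vectors Gamma] when [Gamma] is a union of classes. *)
Definition hmonoid Gamma : set (hclass G) := [set hcl v | v in vectors Gamma]%classic.

Definition smonoid Gamma : set (hclass G) :=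
  [set hcl (uvec Gamma) ^+ k | k in [set: nat]]%classic.

End Hurwitz.

Section Fractions.
Variables (G : finGroupType) (Gamma : {set G}).
Local Notation HG := (hmonoid Gamma).
Local Notation SG := (smonoid Gamma).

Lemma hmonoid1 : HG 1.
Proof. by exists [::]; rewrite ?hcl_nil. Qed.

Lemma hmonoidM c d : HG c -> HG d -> HG (c * d).
Proof.
move=> [v vG <-] [w wG <-]; exists (v ++ w); last by rewrite hcl_cat.
by rewrite /vectors /= all_cat vG.
Qed.

Lemma smonoid1 : SG 1.
Proof. by exists 0. Qed.

Lemma smonoidM c d : SG c -> SG d -> SG (c * d).
Proof. by move=> [k _ <-] [l _ <-]; exists (k + l); rewrite ?expgnDr. Qed.

Lemma smonoid_sub c : SG c -> HG c.
Proof.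
move=> [k _ <-]; elim: k => [|k IH]; first exact: hmonoid1.
rewrite expgS; apply: hmonoidM => //; exists (uvec Gamma) => //.
apply/allP => g /flatten_mapP[h]; rewrite mem_enum => hG.
by rewrite mem_nseq => /andP[_ /eqP ->].
Qed.

Lemma smonoid_central c d : SG c -> c * d = d * c.
Proof.
move=> [k _ <-]; elim/hclass_ind: d => w; elim: k => [|k IH].
  by rewrite expg0 mul1g mulg1.
by rewrite expgS -mulgA IH !mulgA hcl_comm // prod_uvec_of.
Qed.

Definition hfraction := (HG * SG)%type.

Definition frac_eq : rel hfraction := fun p q =>
  `[< exists2 r, HG r & exists2 t, SG t &
      val p.1 * r = val q.1 * t /\ val p.2 * r = val q.2 * t >].

Lemma frac_eq_refl : reflexive frac_eq.
Proof.
move=> p; apply/asboolP; exists 1; first exact: hmonoid1.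
by exists 1; first exact: smonoid1.
Qed.

Lemma frac_eq_sym : symmetric frac_eq.
Proof.
suff S p q : frac_eq p q -> frac_eq q p by move=> p q; apply/idP/idP; exact: S.
move=> /asboolP[r Hr [t St [E1 E2]]]; apply/asboolP.
have Sp : SG (val p.2) by exact: set_mem (valP p.2).
have Sq : SG (val q.2) by exact: set_mem (valP q.2).
exists (t * val p.2); first by apply: smonoid_sub; exact: smonoidM.
exists (r * val p.2); last by rewrite !mulgA E1 E2.
by rewrite -smonoid_central // E2; exact: smonoidM.
Qed.

Lemma frac_eq_trans : transitive frac_eq.
Proof.
move=> q p o /asboolP[r Hr [t St [E1 E2]]] /asboolP[r' Hr' [t' St' [E1' E2']]].
apply/asboolP; exists (r * r'); first exact: hmonoidM.
exists (t' * t); first exact: smonoidM.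
split; rewrite !mulgA ?E1 ?E2 -?E1' -?E2' -!mulgA; congr (_ * _);
  exact: smonoid_central.
Qed.

Canonical frac_eq_rel :=
  EquivRel frac_eq frac_eq_refl frac_eq_sym frac_eq_trans.

Definition hfractions := {eq_quot frac_eq_rel}.

Definition hfrac (x : HG) (s : SG) : hfractions := \pi_hfractions (x, s).

Definition hclass_in (v : seq G) (vG : all [in Gamma] v) : HG :=
  exist _ (hcl v) (mem_set (ex_intro2 _ _ v vG erefl)).

Definition sone : SG := exist _ 1 (mem_set smonoid1).

Lemma fracP (x x' : HG) (s s' : SG) :
  hfrac x s = hfrac x' s' <->
  exists2 r, HG r & exists2 t, SG t &
    val x * r = val x' * t /\ val s * r = val s' * t.
Proof.
split; first by move=> /eqmodP /asboolP.
by move=> h; apply/eqmodP/asboolP.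
Qed.

End Fractions.

(* Main.v *)
Require Import Defs.
From mathcomp Require Import all_boot all_order all_algebra all_fingroup.
From mathcomp Require Import boolp classical_sets functions cardinality.

(* An equality [v/1] = [w/1] means that v and w become braid equivalent after *)
(* juxtaposition with some power of u_Gamma. The Nielsen type is a braid      *)
(* invariant, so it is then the same for v and w, and the injectivity in      *)
(* clause (i) of the stability bound, with H = G, cancels that power.         *)

Set Implicit Arguments.
Unset Strict Implicit.
Unset Printing Implicit Defensive.

Section HurwitzVectors.
Variable G : finGroupType.
Implicit Types v w : seq G.

(** Forward, the fraction depends only on the braid class. Backward, [hfrac_sone_eq] yields a common
    right factor in [smonoid Gamma], and [nielsen_braid_equiv] places both classes in one set
    [classes_gen], on which multiplication by that factor is injective. *)

Lemma nielsen_cons (x : G) v :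
  nielsen (x :: v) = (nielsen [:: x] + nielsen v)%R.
Proof. by rewrite -nielsen_cat. Qed.

Lemma nielsen1J (x y : G) : nielsen [:: (x ^ y)%g] = nielsen [:: x].
Proof.
apply/ffunP=> -[C CG]; rewrite !ffunE /=.
have /imsetP[c _ ->] := CG.
by rewrite !(sameP class_eqP eqP) classGidl ?inE.
Qed.

(** A generator swaps two entries and conjugates one of them, so the conjugacy classes are merely
    permuted. *)
Lemma nielsen_sigma i v : nielsen (sigma i v) = nielsen v.
Proof.
elim: i v => [|i IH] [|x v] //=; last by rewrite nielsen_cons IH -nielsen_cons.
case: v => [|y v] //.
rewrite !(nielsen_cons _ (_ :: _)) !(nielsen_cons _ v) nielsen1J.
exact: GRing.addrCA.
Qed.

Lemma nielsen_braid_equiv v w : braid_equiv v w -> nielsen v = nielsen w.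
Proof.
move=> /braid_equivE[b <-]; elim: b v => //= -[i e] b IH v.
rewrite -IH; case: e; last by rewrite nielsen_sigma.
by rewrite -[in LHS](sigmaVK i v) nielsen_sigma.
Qed.

Lemma vectors_cat (A : {set G}) v w :
  vectors A v -> vectors A w -> vectors A (v ++ w).
Proof. by rewrite /vectors /= all_cat => -> ->. Qed.

(** With both denominators 1, the second equation of [fracP] forces [r = t], so the two multipliers
    agree and lie in [smonoid Gamma]. *)
Lemma hfrac_sone_eq (Gamma : {set G}) v w
    (hv : all [in Gamma] v) (hw : all [in Gamma] w) :
  hfrac (hclass_in hv) (sone Gamma) = hfrac (hclass_in hw) (sone Gamma) ->
  exists2 s, smonoid Gamma s & (hcl v * s = hcl w * s)%g.
Proof.
move=> /fracP[r _ [t St]] /= [Er]; rewrite !mul1g => Ert.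
by exists t; rewrite // -{1}Ert.
Qed.

End HurwitzVectors.

Theorem proposition4p11 (G : finGroupType) (Gamma : {set G}) (m : int)
    (v w : seq G)
    (hGamma : union_of_classes Gamma)
    (hv : all [in Gamma] v) (hw : all [in Gamma] w)
    (hgv : generated_by v = [set: G]%SET)
    (hgw : generated_by w = [set: G]%SET)
    (hm : stability_bound Gamma m)
    (hnu : nielsen_le (nielsen (uvec Gamma) *~ m)%R (nielsen v)) :
  braid_equiv v w <->
  hfrac (hclass_in hv) (sone Gamma) = hfrac (hclass_in hw) (sone Gamma).
Proof.
split=> [vw|/hfrac_sone_eq[s Ss Es]].
  by congr hfrac; apply/val_inj => /=; apply/hclP.
(* Clause (i) multiplies by the class of a vector; entries in [Gamma] keep the type of [v ++ u] in
   [nielsen_image Gamma]. *)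
have [u uGamma us] := smonoid_sub Ss.
rewrite -us in Es.
have Euu : braid_equiv (v ++ u) (w ++ u) by apply/hclP; rewrite !hcl_cat.
(* Types add under juxtaposition, so that of [u] cancels. *)
have nvw : nielsen v = nielsen w.
  have := nielsen_braid_equiv Euu; rewrite !nielsen_cat.
  exact: GRing.addIr.
have nu01 : nielsen_le (nielsen v) (nielsen (v ++ u)).
  by move=> C; rewrite !ffunE count_cat lez_nat leq_addr.
have [_ injG _] := hm.1 _ _ (ex_intro2 _ _ v hv erefl)
  (ex_intro2 _ _ (v ++ u) (vectors_cat hv uGamma) erefl) hnu nu01
  [set: G]%G u (introT allP (fun g _ => finset.in_setT g))
  (etrans (GRing.addrC _ _) (esym (nielsen_cat v u))).
apply/hclP; apply: injG => //; apply: mem_set; first by exists v.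
by exists w.
Qed.
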